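(* Given a sequence of real numbers $\{\alpha_n\}_{n=0}^{\infty}$ such that $|\alpha_n|<1$, $n\ge0$, let $\mu$ be the positive measure on the unit circle $\mathcal{C}$ for which $\alpha_n$ are its Verblunsky coefficients. Then $\mu$ is such that the integral $J=\int_{\mathcal{C}}\zeta(\zeta-1)^{-1}(1-\zeta)^{-1}\,d\mu(\zeta)$ exists if and only if the infinite series $$\sum_{n=1}^{\infty}\prod_{k=1}^{n}\frac{1+\alpha_{k-1}}{1-\alpha_{k-1}}$$ is convergent.
   Context: $\mathcal{C}=\{\zeta\in\mathbb{C}:|\zeta|=1\}$. The Verblunsky coefficients of a measure $\mu$ with infinite support on $\mathcal{C}$ are $\alpha_{n}=-\overline{S_{n+1}(0)}$, $n\ge0$, where $S_n$ is the monic polynomial of degree $n$ orthogonal in $L^2(\mu)$ to all polynomials of lower degree; equivalently $S_n(z)=zS_{n-1}(z)-\overline{\alpha}_{n-1}S_{n-1}^{*}(z)$ with $S_{n}^{*}(z)=z^{n}\overline{S_{n}(1/\bar z)}$. Any sequence with $|\alpha_n|<1$ determines a unique probability measure of infinite support. On $\mathcal{C}\setminus\{1\}$, $\zeta(\zeta-1)^{-1}(1-\zeta)^{-1}=|\zeta-1|^{-2}$; ''$J$ exists'' means the integral is finite. *)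

(* Defs.v *)
From mathcomp Require Import all_boot all_order all_algebra.
From mathcomp Require Import complex.
From mathcomp Require Import all_classical all_reals all_analysis.

Set Implicit Arguments.
Unset Strict Implicit.
Unset Printing Implicit Defensive.

Import Order.TTheory GRing.Theory Num.Theory.
Import numFieldNormedType.Exports.

Local Open Scope classical_set_scope.
Local Open Scope ring_scope.

(* [R[i]] is packed as a [numClosedFieldType] because the library attaches the
   norm topology to that structure and not to the bare type. *)
Definition Cplx (R : realType) : numClosedFieldType := R[i]%C.

Notation borelC R := (g_sigma_algebraType (@open (Cplx R))).

Definition circle (R : realType) : set (Cplx R) := [set z | `|z| = 1].
Arguments circle : clear implicits.

Definition measure_support (R : realType) (mu : {finite_measure set (borelC R) -> \bar R})
  : set (Cplx R) :=
  [set z | forall U : set (Cplx R), open U -> U z -> (0 < mu U)%E].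

Definition circle_integral (R : realType)
    (mu : {finite_measure set (borelC R) -> \bar R}) (f : Cplx R -> Cplx R)
  : Cplx R :=
  Complex (Rintegral mu (circle R) (fun z => complex.Re (f z)))
          (Rintegral mu (circle R) (fun z => complex.Im (f z))).

Definition inner_L2 (R : realType)
    (mu : {finite_measure set (borelC R) -> \bar R}) (p q : {poly Cplx R})
  : Cplx R :=
  circle_integral mu (fun z => p.[z] * (q.[z])^*).

(* For [mu] of infinite support there is exactly one such [S] for each [n]. *)
Definition monic_orthogonal (R : realType)
    (mu : {finite_measure set (borelC R) -> \bar R}) (n : nat)
    (S : {poly Cplx R}) : Prop :=
  [/\ S \is monic, size S = n.+1
    & forall q : {poly Cplx R}, (size q <= n)%N -> inner_L2 mu S q = 0].

Definition is_verblunsky (R : realType)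
    (mu : {finite_measure set (borelC R) -> \bar R}) (n : nat) (a : Cplx R)
  : Prop :=
  exists2 S : {poly Cplx R}, monic_orthogonal mu n.+1 S & a = - (S.[0])^*.

(* On the circle minus 1 the product below is the positive real number
   |z - 1|^-2, so taking its real part loses nothing.  The value at the pole is
   set explicitly because the library's convention [0^-1 = 0] would otherwise
   hide a point mass of the measure at 1. *)
Definition J_integrand (R : realType) (z : Cplx R) : \bar R :=
  if z == 1 then +oo%E
  else (complex.Re (z * (z - 1)^-1 * (1 - z)^-1 : Cplx R))%:E.

Definition J_exists (R : realType)
    (mu : {finite_measure set (borelC R) -> \bar R}) : Prop :=
  mu.-integrable (circle R) (@J_integrand R).

(* Main.v *)
(** Let [L p] be the integral of the real part of
    [(z + 1) (p z - p 1) / (z - 1)] against the measure.  By the Szego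
    recursion, [L S_n] is the value at 1 of the second-kind polynomial, namely
    the total mass times the product of the [1 + alpha_k], while [|S_n|^2] is
    the total mass times the product of the [1 - alpha_k^2].  Hence the partial
    sums of the series are, up to the total mass, the squared norms of [L] on
    the real polynomials of bounded degree, and the series converges iff [L] is
    bounded in L^2.  On the circle [(z + 1) / (z - 1)] is purely imaginary, so
    [p 1] does not contribute when [p] is real, and [L] is bounded as soon as
    [1 / |z - 1|^2] is integrable.  Conversely [D_n = (1 + z)(1 - z^n)/(1 - z)]
    satisfies [L D_n = |D_n|^2 / 2], so a bounded [L] bounds [|D_n|] uniformly;
    averaging over [n] and Fatou's lemma give the integrability. *)

Require Import Defs.
From mathcomp Require Import all_boot all_order all_algebra.
From mathcomp Require Import complex.
From mathcomp Require Import all_classical all_reals all_analysis.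
From mathcomp Require Import measurable_realfun.
From mathcomp Require Import ring lra zify.

Set Implicit Arguments.
Unset Strict Implicit.
Unset Printing Implicit Defensive.

Import Order.TTheory GRing.Theory Num.Theory.
Import numFieldNormedType.Exports.

Local Open Scope classical_set_scope.
Local Open Scope ring_scope.

(** * Integration of polynomials over the unit circle *)

Lemma cReD (R : realType) (x y : Cplx R) :
  complex.Re (x + y) = complex.Re x + complex.Re y.
Proof. by case: x; case: y. Qed.

Lemma cImD (R : realType) (x y : Cplx R) :
  complex.Im (x + y) = complex.Im x + complex.Im y.
Proof. by case: x; case: y. Qed.

Lemma cReN (R : realType) (x : Cplx R) : complex.Re (- x) = - complex.Re x.
Proof. by case: x. Qed.

Lemma cImN (R : realType) (x : Cplx R) : complex.Im (- x) = - complex.Im x.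
Proof. by case: x. Qed.

Lemma cReM (R : realType) (x y : Cplx R) : complex.Re (x * y) =
  complex.Re x * complex.Re y - complex.Im x * complex.Im y.
Proof. by case: x; case: y. Qed.

Lemma cImM (R : realType) (x y : Cplx R) : complex.Im (x * y) =
  complex.Re x * complex.Im y + complex.Im x * complex.Re y.
Proof. by case: x; case: y. Qed.

Lemma conjE (R : realType) (x : Cplx R) : x^* = conjc x.
Proof. by []. Qed.

Lemma cReJ (R : realType) (x : Cplx R) : complex.Re x^* = complex.Re x.
Proof. by rewrite conjE; case: x. Qed.

Lemma cImJ (R : realType) (x : Cplx R) : complex.Im x^* = - complex.Im x.
Proof. by rewrite conjE; case: x. Qed.

Lemma cReR (R : realType) (a : R) : complex.Re (a%:C%C : Cplx R) = a.
Proof. by []. Qed.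

Lemma cImR (R : realType) (a : R) : complex.Im (a%:C%C : Cplx R) = 0.
Proof. by []. Qed.

Lemma Cplx_eq (R : realType) (x y : Cplx R) :
  complex.Re x = complex.Re y -> complex.Im x = complex.Im y -> x = y.
Proof. by case: x y => [a b] [c d] /= -> ->. Qed.

Lemma conj_real_complex (R : realType) (x : R) :
  (x%:C%C : Cplx R)^* = x%:C%C.
Proof. by apply: Cplx_eq; rewrite ?cReJ ?cImJ /= ?oppr0. Qed.

Lemma circleE (R : realType) (z : Cplx R) :
  circle R z <-> complex.Re z ^+ 2 + complex.Im z ^+ 2 = 1.
Proof.
rewrite /circle /=; split.
- move=> h; have := add_Re2_Im2 z; rewrite (_ : `|_| = 1 :> R[i]) // expr1n.
  by case.
- move=> h; rewrite (normc_def z) h sqrtr1; reflexivity.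
Qed.

Lemma circle_conj (R : realType) (z : Cplx R) : circle R z -> z * z^* = 1.
Proof.
move=> /circleE h; apply: Cplx_eq; rewrite ?cReM ?cImM ?cReJ ?cImJ /=; lra.
Qed.

Lemma continuous_Re (R : realType) :
  continuous (fun z : Cplx R => complex.Re z).
Proof.
move=> z; apply/(@cvgrPdist_lt _ _ _ (nbhs z) (nbhs_filter z)) => e e0; near=> t.
have h : `|z - t| < e%:C%C :> Cplx R.
  near: t; apply/nbhs_normP; exists (e%:C%C) => //=; by rewrite ltcR.
rewrite -cReN -cReD -ltcR; exact: le_lt_trans (normc_ge_Re (z - t)) h.
Unshelve. all: by end_near. Qed.

Lemma normc_ge_Im (R : realType) (z : R[i]%C) : `|complex.Im z|%:C%C <= `|z|.
Proof.
by rewrite normc_def lecR -sqrtr_sqr ler_wsqrtr // lerDr sqr_ge0.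
Qed.

Lemma continuous_Im (R : realType) :
  continuous (fun z : Cplx R => complex.Im z).
Proof.
move=> z; apply/(@cvgrPdist_lt _ _ _ (nbhs z) (nbhs_filter z)) => e e0; near=> t.
have h : `|z - t| < e%:C%C :> Cplx R.
  near: t; apply/nbhs_normP; exists (e%:C%C) => //=; by rewrite ltcR.
rewrite -cImN -cImD -ltcR; exact: le_lt_trans (normc_ge_Im (z - t)) h.
Unshelve. all: by end_near. Qed.

Lemma continuous_measurable_borelC (R : realType) (f : Cplx R -> R) :
  continuous f -> measurable_fun [set: borelC R] f.
Proof.
move=> cf; apply: (measurability _ (RGenOInfty.measurableE R)) => // _ [_ [x ->] <-].
rewrite setTI; apply: sub_sigma_algebra.
by move/continuousP: cf; apply; exact: rray_open.
Qed.

Lemma measurable_circle (R : realType) : measurable (circle R : set (borelC R)).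
Proof.
have -> : circle R = (fun z : borelC R => complex.Re z ^+ 2 + complex.Im z ^+ 2)
    @^-1` [set 1].
  by apply/seteqP; split=> z /circleE.
rewrite -[X in measurable X]setTI.
have mRe := continuous_measurable_borelC (@continuous_Re R).
have mIm := continuous_measurable_borelC (@continuous_Im R).
by apply: measurable_funD => //; exact: measurable_funX.
Qed.

(** Polynomials are unbounded on the plane, so the bound is asked on the circle only. The class is
    closed under sums and products and, the measure being finite, its members are integrable on the
    circle. *)
Definition circle_bounded_fun (R : realType) (f : borelC R -> R) : Prop :=
  measurable_fun [set: borelC R] f /\ exists M, forall z, circle R z -> `|f z| <= M.

Lemma circle_boundedD (R : realType) (f g : borelC R -> R) :
  circle_bounded_fun f -> circle_bounded_fun g ->
  circle_bounded_fun (fun z => f z + g z).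
Proof.
move=> [mf [M fM]] [mg [N gN]]; split; first exact: measurable_funD.
exists (M + N) => z Cz; apply: le_trans (ler_normD _ _) _.
by apply: lerD; [exact: fM|exact: gN].
Qed.

Lemma circle_boundedM (R : realType) (f g : borelC R -> R) :
  circle_bounded_fun f -> circle_bounded_fun g ->
  circle_bounded_fun (fun z => f z * g z).
Proof.
move=> [mf [M fM]] [mg [N gN]]; split; first exact: measurable_funM.
exists (M * N) => z Cz; rewrite normrM.
by apply: ler_pM => //; [exact: fM|exact: gN].
Qed.

Lemma circle_bounded_cst (R : realType) (a : R) :
  @circle_bounded_fun R (fun _ => a).
Proof. by split; [exact: measurable_cst|exists `|a|]. Qed.

Lemma circle_boundedN (R : realType) (f : borelC R -> R) :
  circle_bounded_fun f -> circle_bounded_fun (fun z => - f z).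
Proof.
move=> [mf [M fM]]; split; first exact: measurableT_comp.
by exists M => z Cz; rewrite normrN; exact: fM.
Qed.

Lemma circle_bounded_Re (R : realType) :
  @circle_bounded_fun R (fun z => complex.Re z).
Proof.
split; first exact: continuous_measurable_borelC (@continuous_Re R).
exists 1 => z /circleE h; rewrite -[leRHS]sqrtr1 -sqrtr_sqr ler_wsqrtr //.
by rewrite -h lerDl sqr_ge0.
Qed.

Lemma circle_bounded_Im (R : realType) :
  @circle_bounded_fun R (fun z => complex.Im z).
Proof.
split; first exact: continuous_measurable_borelC (@continuous_Im R).
exists 1 => z /circleE h; rewrite -[leRHS]sqrtr1 -sqrtr_sqr ler_wsqrtr //.
by rewrite -h lerDr sqr_ge0.
Qed.

Lemma circle_bounded_poly (R : realType) (p : {poly Cplx R}) :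
  @circle_bounded_fun R (fun z => complex.Re p.[z]) /\
  @circle_bounded_fun R (fun z => complex.Im p.[z]).
Proof.
elim/poly_ind: p => [|p c [IHr IHi]].
  by split; under eq_fun do rewrite horner0; exact: circle_bounded_cst.
split.
  under eq_fun do rewrite hornerMXaddC cReD cReM.
  apply: circle_boundedD (circle_bounded_cst _); apply: circle_boundedD.
    exact: circle_boundedM IHr (@circle_bounded_Re R).
  by apply: circle_boundedN; exact: circle_boundedM IHi (@circle_bounded_Im R).
under eq_fun do rewrite hornerMXaddC cImD cImM.
apply: circle_boundedD (circle_bounded_cst _); apply: circle_boundedD.
  exact: circle_boundedM IHr (@circle_bounded_Im R).
exact: circle_boundedM IHi (@circle_bounded_Re R).
Qed.

Lemma circle_bounded_integrable (R : realType)
    (mu : {finite_measure set (borelC R) -> \bar R}) (f : borelC R -> R) :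
  circle_bounded_fun f -> mu.-integrable (circle R) (EFin \o f).
Proof.
move=> [mf [M fM]]; apply: measurable_bounded_integrable.
- exact: measurable_circle.
- by rewrite ltey_eq fin_num_measure //; exact: measurable_circle.
- exact: measurable_funS mf.
- exists M; split; first exact: num_real.
  by move=> x Mx z /= Cz; apply: le_trans (fM z Cz) (ltW Mx).
Qed.

(** * The real bilinear form of the measure and the second-kind functional *)

Section Form.
Variables (R : realType) (mu : {finite_measure set (borelC R) -> \bar R}).
Implicit Types (p q r : {poly Cplx R}) (a : R).

(** Keeping only the real part of [inner_L2] gives a symmetric real-bilinear form, which is enough
    for real coefficients. *)
Definition re_form p q : R :=
  Rintegral mu (circle R) (fun z => complex.Re (p.[z] * (q.[z])^*)).

Lemma re_form_integrand_bounded p q :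
  @circle_bounded_fun R (fun z => complex.Re (p.[z] * (q.[z])^*)).
Proof.
have [pr pi] := circle_bounded_poly p; have [qr qi] := circle_bounded_poly q.
under eq_fun do rewrite cReM cReJ cImJ mulrN opprK.
by apply: circle_boundedD; exact: circle_boundedM.
Qed.

Lemma re_form_integrable p q :
  mu.-integrable (circle R) (EFin \o (fun z => complex.Re (p.[z] * (q.[z])^*))).
Proof. exact/circle_bounded_integrable/re_form_integrand_bounded. Qed.

Lemma inner_L2_eq0 p q : inner_L2 mu p q = 0 -> re_form p q = 0.
Proof. by case. Qed.

Lemma eq_re_form p q p' q' :
  (forall z, circle R z -> complex.Re (p.[z] * (q.[z])^*) =
                           complex.Re (p'.[z] * (q'.[z])^*)) ->
  re_form p q = re_form p' q'.
Proof. by move=> h; apply: eq_Rintegral => z; rewrite inE => /h. Qed.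

Lemma re_formC p q : re_form p q = re_form q p.
Proof. by apply: eq_re_form => z _; rewrite !cReM !cReJ !cImJ; ring. Qed.

Lemma re_formDl p q r : re_form (p + q) r = re_form p r + re_form q r.
Proof.
rewrite /re_form -RintegralD;
  [|exact: measurable_circle|exact: re_form_integrable..].
by apply: eq_Rintegral => z _; rewrite hornerD mulrDl cReD.
Qed.

Lemma re_formZl a p r : re_form (a%:C%C *: p) r = a * re_form p r.
Proof.
rewrite /re_form -RintegralZl;
  [|exact: measurable_circle|exact: re_form_integrable].
by apply: eq_Rintegral => z _; rewrite hornerZ -mulrA cReM cReR cImR mul0r subr0.
Qed.

Lemma re_formNl p r : re_form (- p) r = - re_form p r.
Proof.
by rewrite -[RHS]mulN1r -re_formZl (rmorphN (real_complex R)) scaleN1r.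
Qed.

Lemma re_formBl p q r : re_form (p - q) r = re_form p r - re_form q r.
Proof. by rewrite re_formDl re_formNl. Qed.

Lemma re_formDr p q r : re_form r (p + q) = re_form r p + re_form r q.
Proof. by rewrite re_formC re_formDl !(re_formC r). Qed.

Lemma re_formZr a p r : re_form r (a%:C%C *: p) = a * re_form r p.
Proof. by rewrite re_formC re_formZl (re_formC r). Qed.

Lemma re_formBr p q r : re_form r (p - q) = re_form r p - re_form r q.
Proof. by rewrite re_formC re_formBl !(re_formC r). Qed.

Lemma re_form0l r : re_form 0 r = 0.
Proof. by rewrite -(subrr 0) re_formBl subrr. Qed.

Lemma re_form0r r : re_form r 0 = 0.
Proof. by rewrite re_formC re_form0l. Qed.

Lemma re_form_ge0 p : 0 <= re_form p p.
Proof.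
apply: Rintegral_ge0 => z _.
by rewrite cReM cReJ cImJ mulrN opprK addr_ge0 // -expr2 sqr_ge0.
Qed.

(** Multiplication by z is an isometry because z has modulus 1 on the circle. *)
Lemma re_formX p q : re_form ('X * p) ('X * q) = re_form p q.
Proof.
apply: eq_re_form => z Cz; rewrite !hornerE rmorphM /=.
by rewrite mulrACA circle_conj // mul1r.
Qed.

(** Degenerate Cauchy-Schwarz: if p has norm zero, the squared norm of q - a p is affine in a and
    nonnegative, so its slope vanishes. *)
Lemma re_form_isotropic p q : re_form p p = 0 -> re_form p q = 0.
Proof.
move=> p0; have h a := re_form_ge0 (q - a%:C%C *: p).
have {}h a : 0 <= re_form q q - 2 * a * re_form p q.
  have := h a; rewrite re_formBl !re_formBr !re_formZl !re_formZr p0.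
  rewrite (re_formC q p); lra.
apply/eqP; apply: contraT => b0.
(* At this value of a the affine function equals -1. *)
have := h ((re_form q q + 1) / (2 * re_form p q)).
rewrite (_ : _ - _ = - 1); first lra.
field; exact: b0.
Qed.

(** [re_form] is only real-linear, so L is merely additive and the monomials carry arbitrary complex
    coefficients. *)
Lemma additive_monomials_eq0 n (L : {poly Cplx R} -> R) :
  (forall p q, L (p + q) = L p + L q) ->
  (forall c j, (j < n)%N -> L (c *: 'X^j) = 0) ->
  forall q, (size q <= n)%N -> L q = 0.
Proof.
move=> LD; elim: n => [|n IH] h q.
  rewrite leqn0 size_poly_eq0 => /eqP ->.
  by apply: (addrI (L 0)); rewrite -LD !addr0.
move=> sq; rewrite (_ : q = (q - q`_n *: 'X^n) + q`_n *: 'X^n); last by rewrite subrK.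
rewrite LD h // addr0; apply: IH => [c j jn|]; first exact/h/ltnW.
apply/leq_sizeP => j; rewrite leq_eqVlt coefB coefZ coefXn => /orP[/eqP <-|nj].
  by rewrite eqxx mulr1 subrr.
by rewrite gtn_eqF // mulr0 subr0; exact: (leq_sizeP _ _ sq).
Qed.

(* The integrand [(z + 1) (p z - p 1) / (z - 1)] is a polynomial in [z]: the
   division drops the remainder [p 1].  On S_n this is, for n > 0, the value at 1
   of the second-kind polynomial. *)
Definition second_kind p : R :=
  re_form (('X + 1) * (p %/ ('X - 1%:P))) 1.

Lemma second_kindD p q : second_kind (p + q) = second_kind p + second_kind q.
Proof. by rewrite /second_kind divpD mulrDr re_formDl. Qed.

Lemma second_kindZ a p : second_kind (a%:C%C *: p) = a * second_kind p.
Proof. by rewrite /second_kind divpZl -scalerAr re_formZl. Qed.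

Lemma second_kindN p : second_kind (- p) = - second_kind p.
Proof. by rewrite -[RHS]mulN1r -second_kindZ (rmorphN (real_complex R)) scaleN1r. Qed.

Lemma second_kindB p q : second_kind (p - q) = second_kind p - second_kind q.
Proof. by rewrite second_kindD second_kindN. Qed.

Lemma second_kindC c : second_kind c%:P = 0.
Proof.
rewrite /second_kind divp_small ?mulr0 ?re_form0l //.
by rewrite size_XsubC ltnS size_polyC_leq1.
Qed.

(** Since z p = (z - 1) p + p, the quotient by z - 1 increases by exactly p. *)
Lemma second_kindX p :
  second_kind ('X * p) = second_kind p + re_form (('X + 1) * p) 1.
Proof.
rewrite /second_kind (_ : 'X * p = ('X - 1%:P) * p + p); last by rewrite polyC1; ring.
by rewrite divpD mulKp ?polyXsubC_eq0 // mulrDr re_formDl addrC.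
Qed.

End Form.

(** * Szego recursion and the functional [second_kind] *)

(** The recursion runs on the pair of S_n and its reversal, so no reversal operator has to be
    defined; no conjugate appears because the coefficients are real. *)
Fixpoint szego (R : realType) (a : nat -> R) (n : nat) :
    {poly Cplx R} * {poly Cplx R} :=
  if n is m.+1 then
    let: (s, t) := szego a m in
    ('X * s - (a m)%:C%C *: t, t - (a m)%:C%C *: ('X * s))
  else (1, 1).

(* [szego_rev a n] is the reversed polynomial S_n^*, see [szego_rev_circle]. *)
Definition szego_poly (R : realType) (a : nat -> R) n := (szego a n).1.
Definition szego_rev (R : realType) (a : nat -> R) n := (szego a n).2.

Definition real_poly (R : realType) (p : {poly Cplx R}) : Prop :=
  map_poly Num.conj p = p.

Section Szego.
Variables (R : realType) (a : nat -> R).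
Notation S := (szego_poly a).
Notation T := (szego_rev a).
Implicit Types (p q : {poly Cplx R}).

Lemma szego_poly0 : S 0 = 1. Proof. by []. Qed.

Lemma szego_rev0 : T 0 = 1. Proof. by []. Qed.

Lemma szego_polyS n : S n.+1 = 'X * S n - (a n)%:C%C *: T n.
Proof. by rewrite /szego_poly /szego_rev /=; case: szego. Qed.

Lemma szego_revS n : T n.+1 = T n - (a n)%:C%C *: ('X * S n).
Proof. by rewrite /szego_poly /szego_rev /=; case: szego. Qed.

(** On the circle the conjugate of z is 1/z, which turns the coupled recursion into the defining
    identity of the reversed polynomial. *)
Lemma szego_rev_circle n (z : Cplx R) :
  circle R z -> (T n).[z] = z ^+ n * (S n).[z]^*.
Proof.
move=> Cz; have zz := circle_conj Cz.
elim: n => [|n IH].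
  by rewrite szego_poly0 szego_rev0 !hornerE rmorph1.
rewrite szego_revS szego_polyS !hornerE IH rmorphB !rmorphM /= conjCK.
rewrite conj_real_complex.
have zzn : z ^+ n * (z ^+ n)^* = 1 by rewrite rmorphXn -exprMn zz expr1n.
rewrite exprS.
rewrite (_ : z * z ^+ n * _ = z ^+ n * ((S n).[z])^* * (z * z^*)
  - (a n)%:C%C * (z * (S n).[z]) * (z ^+ n * (z ^+ n)^*)); last first.
  by rewrite rmorphXn; ring.
by rewrite zz zzn !mulr1 mulrA.
Qed.

Lemma szego_size n :
  [/\ size (S n) = n.+1, S n \is monic & (size (T n) <= n.+1)%N].
Proof.
elim: n => [|n [sS mS sT]].
  by rewrite szego_poly0 szego_rev0 size_poly1 monic1.
have sXS : size ('X * S n) = n.+2.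
  by rewrite size_monicM ?monicX ?monic_neq0 // size_polyX sS.
have sZ c p : (size (c *: p) <= size p)%N by exact: size_scale_leq.
have lt1 : (size (- ((a n)%:C%C *: T n))%R < size ('X * S n)%R)%N.
  by rewrite size_polyN sXS ltnS (leq_trans (sZ _ _)).
split; first by rewrite szego_polyS size_polyDl.
- by rewrite szego_polyS monicE lead_coefDl // -monicE monicMl // monicX.
- rewrite szego_revS (leq_trans (size_polyD _ _)) // geq_max size_polyN.
  by rewrite (leq_trans sT) //= (leq_trans (sZ _ _)) // sXS.
Qed.

(** Through the recursion this yields S_{n+1}(0) = - a n, the link with the Verblunsky
    coefficients. *)
Lemma szego_rev_horner0 n : (T n).[0] = 1.
Proof.
elim: n => [|n IH]; first by rewrite szego_rev0 hornerE.
by rewrite szego_revS hornerD hornerN hornerZ hornerM hornerX IH; ring.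
Qed.

Lemma szego_real n : real_poly (S n) /\ real_poly (T n).
Proof.
elim: n => [|n [IS IT]].
  by rewrite szego_poly0 szego_rev0 /real_poly rmorph1.
rewrite /real_poly szego_polyS szego_revS !rmorphB /= !map_polyZ /= rmorphM.
by rewrite /= map_polyX IS IT conj_real_complex.
Qed.

End Szego.

(** * The recursion produces the orthogonal polynomials *)

Section Orthogonality.
Variables (R : realType) (mu : {finite_measure set (borelC R) -> \bar R}).
Variable (a : nat -> R).
Notation S := (szego_poly a).
Notation T := (szego_rev a).
Implicit Types (p q : {poly Cplx R}).
Hypothesis a_verblunsky : forall n, is_verblunsky mu n (a n)%:C%C.

(** On the circle, pairing [T n] with c z^(j+1) amounts to pairing conj(c) z^(n-j-1) with [S n], and
    that monomial has degree below n. *)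
Lemma szego_rev_orthogonal n :
  (forall q, (size q <= n)%N -> re_form mu (S n) q = 0) ->
  forall q, (size q <= n)%N -> re_form mu (T n) ('X * q) = 0.
Proof.
move=> SO; apply: additive_monomials_eq0 => [p q|c j jn].
  by rewrite mulrDr re_formDr.
rewrite -(SO (c^* *: 'X^(n - j.+1))); last first.
  by rewrite (leq_trans (size_scale_leq _ _)) // size_polyXn subnSK // leq_subr.
rewrite [RHS]re_formC; apply: eq_re_form => z Cz.
rewrite szego_rev_circle // !(hornerM, hornerZ, hornerX, hornerXn).
rewrite -{1}(subnK jn) exprD exprS !rmorphM rmorphXn.
have zz := circle_conj Cz.
have e : z ^+ j * z^* ^+ j = 1 by rewrite -exprMn zz expr1n.
congr complex.Re; transitivity (c^* * z ^+ (n - j.+1) * (S n).[z]^* *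
    (z * z^*) * (z ^+ j * z^* ^+ j)); first by ring.
by rewrite zz e !mulr1.
Qed.

(** Let U be the orthogonal polynomial supplied by [is_verblunsky]. Both U and [S n.+1] are monic
    and take the value - a n at 0, so their difference d is z e with e of size at most n. Both are
    orthogonal to z e, so d has norm zero, and [S n.+1] inherits the orthogonality of U. *)
Lemma szego_orthogonal n q : (size q <= n)%N -> re_form mu (S n) q = 0.
Proof.
elim: n q => [|n IH] q.
  by rewrite leqn0 size_poly_eq0 => /eqP ->; exact: re_form0r.
move=> sq; have [U [mU sU oU] U0] := a_verblunsky n.
have TO := szego_rev_orthogonal IH.
have [sS mS _] := szego_size a n.+1.
pose d := U - S n.+1.
have sd : (size d <= n.+1)%N.
  apply/leq_sizeP => j; rewrite leq_eqVlt coefB => /orP[/eqP <-|nj].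
    have := monicP mU; have := monicP mS; rewrite !lead_coefE sU sS /= => -> ->.
    by rewrite subrr.
  by rewrite !nth_default ?subrr // ?sU ?sS.
have d0 : d.[0] = 0.
  rewrite /d szego_polyS !(hornerD, hornerN, hornerZ, hornerM, hornerX).
  rewrite szego_rev_horner0 -conj_real_complex U0 rmorphN /= conjCK; ring.
have [e de] : exists e, d = 'X * e.
  have /factor_theorem[e ->] : root d 0 by apply/eqP.
  by exists e; rewrite subr0 mulrC.
have se : (size e <= n)%N.
  have [->|e0] := eqVneq e 0; first by rewrite size_poly0.
  by move: sd; rewrite de mulrC size_mulX.
(* Only the second d is written as z e; the first is split into U, z [S n] and [T n], each of which
   is orthogonal to z e. *)
have dd : re_form mu d d = 0.
  rewrite {2}de {1}/d szego_polyS !re_formBl re_formX re_formZl IH // TO //.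
  rewrite mulr0 !subr0; apply: inner_L2_eq0; apply: oU.
  by rewrite mulrC (leq_trans (size_polyMleq _ _)) // size_polyX addn2 /= ltnS.
have -> : S n.+1 = U - d by rewrite /d; ring.
rewrite re_formBl (re_form_isotropic _ dd) subr0; apply: inner_L2_eq0; exact: oU.
Qed.

End Orthogonality.

(** * Norms, second-kind values and the representer *)

Section Moments.
Variables (R : realType) (mu : {finite_measure set (borelC R) -> \bar R}).
Variable (a : nat -> R).
Notation S := (szego_poly a).
Notation T := (szego_rev a).
Notation m0 := (re_form mu 1 1).
Implicit Types (p q : {poly Cplx R}).
Hypothesis a_verblunsky : forall n, is_verblunsky mu n (a n)%:C%C.

Let orth := szego_orthogonal a_verblunsky.

Lemma szego_rev_norm n : re_form mu (T n) (T n) = re_form mu (S n) (S n).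
Proof.
apply: eq_re_form => z Cz; rewrite szego_rev_circle // rmorphM /= conjCK.
have e : z ^+ n * (z ^+ n)^* = 1.
  by rewrite rmorphXn -exprMn circle_conj // expr1n.
congr complex.Re; transitivity ((z ^+ n * (z ^+ n)^*) * ((S n).[z] * (S n).[z]^*)).
  by ring.
by rewrite e mul1r.
Qed.

(** The left side is the pairing of z^n with [S n], and z^n - [S n] has degree below n. *)
Lemma szego_rev_mean n : re_form mu (T n) 1 = re_form mu (S n) (S n).
Proof.
have [sS mS _] := szego_size a n.
transitivity (re_form mu 'X^n (S n)).
  by apply: eq_re_form => z Cz; rewrite szego_rev_circle // hornerC hornerXn rmorph1 mulr1.
apply/eqP; rewrite -subr_eq0 -re_formBl re_formC orth //.
apply/leq_sizeP => j; rewrite leq_eqVlt coefB coefXn => /orP[/eqP <-|nj].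
  by rewrite eqxx; move/monicP: mS; rewrite lead_coefE sS /= => ->; rewrite subrr.
by rewrite gtn_eqF // nth_default ?subrr // sS.
Qed.

Lemma szego_mean n : re_form mu (S n.+1) 1 = 0.
Proof. by rewrite orth // size_poly1. Qed.

Lemma szego_shift_mean n :
  re_form mu ('X * S n) 1 = a n * re_form mu (S n) (S n).
Proof.
have := szego_mean n.
by rewrite szego_polyS re_formBl re_formZl szego_rev_mean => /subr0_eq.
Qed.

(** Pythagoras in z S_n = S_{n+1} + a_n T_n: the summands are orthogonal, while z S_n and T_n both
    have the norm of S_n. *)
Lemma szego_normS n :
  re_form mu (S n.+1) (S n.+1) = (1 - a n ^+ 2) * re_form mu (S n) (S n).
Proof.
have [_ _ sT] := szego_size a n.
have h1 : re_form mu (S n.+1) (T n) = 0 by rewrite orth.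
have XS : 'X * S n = S n.+1 + (a n)%:C%C *: T n by rewrite szego_polyS subrK.
have := re_formX mu (S n) (S n); rewrite XS.
rewrite !(re_formDl, re_formDr, re_formZl, re_formZr) (re_formC _ (T n) (S n.+1)).
rewrite h1 szego_rev_norm => h2; lra.
Qed.

Lemma szego_norm n :
  re_form mu (S n) (S n) = m0 * \prod_(i < n) (1 - a i ^+ 2).
Proof.
elim: n => [|n IH]; first by rewrite big_ord0 mulr1.
by rewrite szego_normS big_ord_recr IH /=; ring.
Qed.

(** The two identities need a joint induction. The term [re_form mu (S n) 1] vanishes for n > 0 and
    corrects the case n = 0, where [second_kind] is 0 but the product gives the total mass. *)
Lemma szego_second_kind_pair n :
  second_kind mu (S n) + re_form mu (S n) 1 = m0 * \prod_(i < n) (1 + a i) /\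
  second_kind mu (T n) =
    re_form mu (S n) (S n) - m0 * \prod_(i < n) (1 + a i).
Proof.
elim: n => [|n [IS IT]].
  by rewrite szego_poly0 szego_rev0 -polyC1 second_kindC big_ord0; lra.
have e : second_kind mu ('X * S n) =
    m0 * \prod_(i < n) (1 + a i) + a n * re_form mu (S n) (S n).
  by rewrite second_kindX mulrDl mul1r re_formDl szego_shift_mean -IS; lra.
rewrite szego_mean szego_normS big_ord_recr /= szego_polyS szego_revS.
by rewrite !second_kindB !second_kindZ e IT; split; ring.
Qed.

Lemma szego_second_kind n :
  second_kind mu (S n.+1) = m0 * \prod_(i < n.+1) (1 + a i).
Proof. by have [<- _] := szego_second_kind_pair n.+1; rewrite szego_mean addr0. Qed.

Hypothesis a_lt1 : forall n, `|a n| < 1.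

(** The Riesz representer of [second_kind] on real polynomials of degree at most n, expanded in the
    orthogonal basis: the coefficient is [second_kind] of S_k over the squared norm of S_k. S_0 is
    absent because [second_kind] kills constants. *)
Fixpoint representer n : {poly Cplx R} :=
  if n is m.+1 then
    representer m + (\prod_(i < m.+1) (1 - a i)^-1)%:C%C *: S m.+1
  else 0.

Lemma size_representer n : (size (representer n) <= n.+1)%N.
Proof.
elim: n => [|n IH] /=; first by rewrite size_poly0.
rewrite (leq_trans (size_polyD _ _)) // geq_max (leq_trans IH) //=.
by rewrite (leq_trans (size_scale_leq _ _)) //; have [-> _ _] := szego_size a n.+1.
Qed.

Lemma representer_real n : real_poly (representer n).
Proof.
rewrite /real_poly; elim: n => [|n IH] /=; first by rewrite rmorph0.
by rewrite rmorphD /= map_polyZ /= IH conj_real_complex (szego_real a n.+1).1.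
Qed.

Lemma prod_inv_sub_sqr n :
  (\prod_(i < n) (1 - a i)^-1) * \prod_(i < n) (1 - a i ^+ 2) =
  \prod_(i < n) (1 + a i).
Proof.
rewrite -big_split /=; apply: eq_bigr => i _.
have := a_lt1 i; rewrite ltr_norml => /andP[_ h].
by field; rewrite subr_eq0 gt_eqF.
Qed.

Lemma representerP n p : real_poly p -> (size p <= n.+1)%N ->
  re_form mu p (representer n) = second_kind mu p.
Proof.
elim: n p => [|n IH] p rp sp.
  by rewrite (size1_polyC sp) second_kindC re_form0r.
have [sS mS _] := szego_size a n.+1.
(* A real top coefficient lets the real-linear form split off the multiple of [S n.+1]. *)
have [k bk] : exists k, p`_n.+1 = k%:C%C.
  exists (complex.Re p`_n.+1); have : (p`_n.+1)^* = p`_n.+1 by rewrite -coef_map /= rp.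
  move=> h; apply: Cplx_eq => //=; move: (congr1 (fun z : Cplx R => complex.Im z) h).
  by rewrite cImJ; lra.
pose q := p - k%:C%C *: S n.+1.
have rq : real_poly q.
  by rewrite /real_poly rmorphB /= map_polyZ /= rp conj_real_complex (szego_real a n.+1).1.
have sq : (size q <= n.+1)%N.
  apply/leq_sizeP => j; rewrite leq_eqVlt coefB coefZ => /orP[/eqP <-|nj].
    by move/monicP: mS; rewrite lead_coefE sS /= => ->; rewrite bk mulr1 subrr.
  rewrite (leq_sizeP _ _ sp) // sub0r [X in _ * X]nth_default ?sS //.
  by rewrite mulr0 oppr0.
have -> : p = q + k%:C%C *: S n.+1 by rewrite /q subrK.
clearbody q.
rewrite /= second_kindD second_kindZ !(re_formDl, re_formDr, re_formZl, re_formZr).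
rewrite IH // (re_formC _ q (S _)) (orth sq) (orth (size_representer n)).
rewrite szego_second_kind szego_norm -prod_inv_sub_sqr; ring.
Qed.

Definition second_kind_series n : R :=
  \sum_(1 <= i < n.+1) \prod_(1 <= k < i.+1) ((1 + a k.-1) / (1 - a k.-1)).

(** The squared norm of the representer is [second_kind] of the representer itself; each S_k
    contributes its value squared over its squared norm, which is m0 times a term of the series. *)
Lemma representer_norm n :
  re_form mu (representer n) (representer n) = m0 * second_kind_series n.
Proof.
rewrite (representerP (representer_real n) (size_representer n)).
elim: n => [|n IH] /=.
  by rewrite -polyC0 second_kindC /second_kind_series big_geq // mulr0.
rewrite second_kindD second_kindZ IH szego_second_kind.
rewrite /second_kind_series [in RHS]big_nat_recr //= mulrDr; congr (_ + _).
rewrite mulrCA; congr (_ * _); rewrite -big_split /= big_add1 /= big_mkord.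
by apply: eq_bigr => i _; rewrite mulrC.
Qed.

End Moments.

(** * The integrand of J and the test polynomials *)

Section Pointwise.
Variable R : realType.
Implicit Types (p q : {poly Cplx R}) (z : Cplx R).

(* Equals [|z - 1|^2] on the circle. *)
Definition chord_sqr z : R := 2 - 2 * complex.Re z.

Lemma chord_sqr_gt0 z : circle R z -> z != 1 -> 0 < chord_sqr z.
Proof.
move=> /circleE h z1; rewrite /chord_sqr lt_neqAle; apply/andP; split.
  apply: contra z1 => /eqP h0; apply/eqP; apply: Cplx_eq => /=; first lra.
  apply/eqP; rewrite -sqrf_eq0; apply/eqP.
  have e : complex.Re z = 1 by lra. by move: h; rewrite e; lra.
by have := sqr_ge0 (complex.Im z); nra.
Qed.

Lemma chord_sqr1 : chord_sqr (1 : Cplx R) = 0.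
Proof. by rewrite /chord_sqr /=; lra. Qed.

Lemma chord_sqrE z : circle R z ->
  (chord_sqr z)%:C%C * z = (z - 1) * (1 - z) :> Cplx R.
Proof.
move=> /circleE h; rewrite /chord_sqr.
apply: Cplx_eq; rewrite !(cReM, cImM, cReD, cImD, cReN, cImN, cReR, cImR) /=; nra.
Qed.

Lemma J_integrandE z : circle R z -> z != 1 ->
  J_integrand z = ((chord_sqr z)^-1)%:E.
Proof.
move=> Cz z1; rewrite /J_integrand (negPf z1); congr EFin.
have n0 := chord_sqr_gt0 Cz z1.
have z0 : z != 0.
  by apply/eqP => z0; move/circleE: Cz; rewrite z0 /= expr0n /=; lra.
have nC : ((chord_sqr z)%:C%C : Cplx R) != 0.
  by apply/eqP => /(congr1 (fun w : Cplx R => complex.Re w)) /= /eqP; rewrite gt_eqF.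
have e : z * (z - 1)^-1 * (1 - z)^-1 = ((chord_sqr z)%:C%C : Cplx R)^-1.
  rewrite -mulrA -invfM -chord_sqrE // invfM mulrCA mulfV // mulr1 //.
rewrite e (_ : (_)^-1 = ((chord_sqr z)^-1)%:C%C) //.
apply: (mulfI nC); rewrite mulfV //; apply: Cplx_eq; rewrite ?cReM ?cImM /=.
  by rewrite mulfV ?gt_eqF // mulr0 subr0.
by rewrite mulr0 mul0r addr0.
Qed.

Lemma J_integrand_ge0 z : circle R z -> (0 <= J_integrand z)%E.
Proof.
move=> Cz; have [->|z1] := eqVneq z 1; first by rewrite /J_integrand eqxx.
by rewrite J_integrandE // lee_fin invr_ge0 ltW // chord_sqr_gt0.
Qed.

Lemma measurable_J_integrand :
  measurable_fun (circle R : set (borelC R)) (@J_integrand R).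
Proof.
apply: (measurability _ (ErealGenOInfty.measurableE R)) => // _ [_ [r ->] <-].
(* Multiplying out, J > r becomes r |z - 1|^2 < 1, which is also correct at z = 1, where both hold
   for every r. *)
rewrite (_ : _ `&` _ = circle R `&`
    (fun z : borelC R => r * chord_sqr z) @^-1` `]-oo, 1[); last first.
  apply/seteqP; split=> z [Cz]; rewrite !set_itvE /= => h; split=> //;
    move: h; have [z1|z1] := eqVneq z 1.
  - by rewrite z1 chord_sqr1 mulr0.
  - by rewrite -ltr_pdivlMr ?chord_sqr_gt0 // -lte_fin div1r -J_integrandE.
  - by rewrite z1 /J_integrand eqxx ltry.
  - by rewrite J_integrandE // lte_fin -div1r ltr_pdivlMr // chord_sqr_gt0.
apply: measurableI; first exact: measurable_circle.
have mRe := continuous_measurable_borelC (@continuous_Re R).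
have mf : measurable_fun [set: borelC R] (fun z => r * chord_sqr z).
  by apply: measurable_funM => //; apply: measurable_funB => //; exact: measurable_funM.
by rewrite -[X in measurable X]setTI; apply: mf => //; exact: measurable_itv.
Qed.

(** On the circle (z + 1) / (z - 1) is -2i Im z / |z - 1|^2, and p 1 is real, so only the imaginary
    part of p z survives. *)
Lemma second_kind_integrand p z : circle R z -> z != 1 -> real_poly p ->
  complex.Re ((('X + 1) * (p %/ ('X - 1%:P))).[z] * (1%R : {poly Cplx R}).[z]^*) =
  2 * complex.Im z * complex.Im p.[z] / chord_sqr z.
Proof.
move=> Cz z1 rp; have n0 := chord_sqr_gt0 Cz z1.
have f0 : complex.Im p.[1] = 0.
  have : (p.[1])^* = p.[1] by rewrite -{2}rp -[in RHS](rmorph1 Num.conj) horner_map.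
  by move/(congr1 (fun w : Cplx R => complex.Im w)); rewrite cImJ; lra.
have := congr1 (fun r => r.[z]) (divp_eq p ('X - 1%:P)).
rewrite modp_XsubC !(hornerM, hornerD, hornerN, hornerX, hornerC).
set K := (_ %/ _).[z]; set P := p.[z] => e.
have /circleE h := Cz; rewrite /chord_sqr in n0 *.
have e2 : complex.Im P = complex.Im (K * (z - 1) + p.[1]) by rewrite e.
move: e2; rewrite !(cReM, cImM, cReD, cImD, cReN, cImN) /= f0 => e2.
apply: (mulIf (lt0r_neq0 n0)); rewrite mulfVK ?lt0r_neq0 // e2.
apply/eqP; rewrite -subr_eq0; apply/eqP.
transitivity (2 * complex.Re K *
    (1 - (complex.Re z ^+ 2 + complex.Im z ^+ 2))); first by ring.
by rewrite h subrr mulr0.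
Qed.

Lemma second_kind_integrand_le p z : circle R z -> real_poly p ->
  ((complex.Re ((('X + 1) * (p %/ ('X - 1%:P))).[z] *
      (1%R : {poly Cplx R}).[z]^*))%:E <=
   2%:E * J_integrand z + (complex.Re (p.[z] * p.[z]^*) / 2)%:E)%E.
Proof.
move=> Cz rp; have [->|z1] := eqVneq z 1.
  by rewrite /J_integrand eqxx mulry gtr0_sg // mul1e addye // leey.
rewrite second_kind_integrand // J_integrandE //= -EFinM -EFinD lee_fin.
have n0 := chord_sqr_gt0 Cz z1; rewrite cReM cReJ cImJ.
have /circleE := Cz.
move: (complex.Re p.[z]) (complex.Im p.[z]) => u v h.
(* With v = Im p z and y = Im z, the bound is 2 v (y/n) <= v^2 / 2 + 2 (y/n)^2 combined with y^2 <=
   n. *)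
set n := chord_sqr z in n0 *; set y := complex.Im z in h *.
have nE : n = 2 - 2 * complex.Re z by [].
have yn : y ^+ 2 <= n.
  by have := sqr_ge0 (complex.Re z - 1); rewrite nE; nra.
have s0 := sqr_ge0 (v - 2 * (y / n)).
have yyn : (y / n) ^+ 2 <= n^-1.
  rewrite expr_div_n ler_pdivrMr ?exprn_gt0 // expr2 mulKf ?gt_eqF //.
have -> : 2 * y * v / n = 2 * v * (y / n) by ring.
have := sqr_ge0 u; nra.
Qed.

Definition dirichlet n : {poly Cplx R} :=
  \sum_(j < n) ('X^j + 'X^(j.+1)).

Lemma size_dirichlet n : (size (dirichlet n) <= n.+1)%N.
Proof.
rewrite (leq_trans (size_sum _ _ _)) //; apply/bigmax_leqP => j _.
rewrite (leq_trans (size_polyD _ _)) // geq_max !size_polyXn !ltnS.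
by rewrite ltn_ord ltnW // ltn_ord.
Qed.

Lemma dirichlet_real n : real_poly (dirichlet n).
Proof.
rewrite /real_poly /dirichlet rmorph_sum; apply: eq_bigr => j _.
by rewrite rmorphD /= !map_polyXn.
Qed.

Lemma dirichlet_telescope n z :
  (1 - z) * (dirichlet n).[z] = (1 + z) * (1 - z ^+ n).
Proof.
elim: n => [|n IH]; first by rewrite /dirichlet big_ord0 horner0 expr0; ring.
rewrite /dirichlet big_ord_recr /= hornerD mulrDr IH !(hornerD, hornerXn) exprS; ring.
Qed.

Lemma circleX n z : circle R z -> circle R (z ^+ n).
Proof. by rewrite /circle /= normrX => ->; rewrite expr1n. Qed.

(** With t = 2 Im z / |z - 1|^2 one has (1 + z) / (1 - z) = i t, hence D_n = i t (1 - z^n). *)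
Lemma dirichlet_circle n z : circle R z -> z != 1 ->
  complex.Im (dirichlet n).[z] =
    2 * complex.Im z / chord_sqr z * (1 - complex.Re (z ^+ n)) /\
  complex.Re ((dirichlet n).[z] * (dirichlet n).[z]^*) =
    2 * (2 * complex.Im z / chord_sqr z) ^+ 2 * (1 - complex.Re (z ^+ n)).
Proof.
move=> Cz z1; have n0 := chord_sqr_gt0 Cz z1.
have := dirichlet_telescope n z; have /circleE := circleX n Cz.
have /circleE h := Cz.
set D := (dirichlet n).[z]; set w := z ^+ n => hw e.
have nE : chord_sqr z = 2 - 2 * complex.Re z by [].
have e1 := congr1 (fun r : Cplx R => complex.Re r) e.
have e2 := congr1 (fun r : Cplx R => complex.Im r) e.
move: e1 e2; rewrite /= !(cReM, cImM, cReD, cImD, cReN, cImN) /= !cReJ !cImJ.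
move: (complex.Re D) (complex.Im D) (complex.Re w) (complex.Im w) hw => u v c s hw.
move: (complex.Re z) (complex.Im z) h nE => x y h nE e1 e2.
have n0' := lt0r_neq0 n0.
have nsq : chord_sqr z = (1 - x) ^+ 2 + y ^+ 2 by rewrite nE; nra.
have y2 : y ^+ 2 = 1 - x ^+ 2 by lra.
(* Both parts of D_n come from multiplying the telescoped identity by the conjugate of 1 - z. *)
have vE : v = 2 * y / chord_sqr z * (1 - c).
  apply: (mulIf n0'); rewrite mulrAC divfK // nsq.
  transitivity ((1 - x) * ((1 - x) * v + (- y) * u) + y * ((1 - x) * u - (-y) * v)); first by ring.
  have -> : (1 - x) * v + (- y) * u = (1 + x) * (- s) + y * (1 - c) by lra.
  have -> : (1 - x) * u - (- y) * v = (1 + x) * (1 - c) + y * s by lra.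
  transitivity (2 * y * (1 - c) + s * (y ^+ 2 - (1 - x ^+ 2))); first by ring.
  by rewrite y2 subrr mulr0 addr0.
have uE : u = 2 * y / chord_sqr z * s.
  apply: (mulIf n0'); rewrite mulrAC divfK // nsq.
  transitivity ((1 - x) * ((1 - x) * u - (-y) * v) - y * ((1 - x) * v + (- y) * u)); first by ring.
  have -> : (1 - x) * v + (- y) * u = (1 + x) * (- s) + y * (1 - c) by lra.
  have -> : (1 - x) * u - (- y) * v = (1 + x) * (1 - c) + y * s by lra.
  transitivity (2 * y * s + (1 - c) * ((1 - x ^+ 2) - y ^+ 2)); first by ring.
  by rewrite y2 subrr mulr0 addr0.
split=> //; rewrite uE vE; set t := 2 * y / chord_sqr z.
transitivity (t ^+ 2 * (c ^+ 2 + s ^+ 2 + 1 - 2 * c)); first by ring.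
by rewrite hw; ring.
Qed.

End Pointwise.

Section Dirichlet.
Variable R : realType.
Implicit Types (z : Cplx R).

Lemma dirichlet_horner1 n : (dirichlet R n).[1] = ((2 * n)%N%:R : R)%:C%C.
Proof.
rewrite rmorph_nat; elim: n => [|n IH]; first by rewrite /dirichlet big_ord0 horner0.
rewrite /dirichlet big_ord_recr /= hornerD IH !(hornerD, hornerXn) !expr1n.
by rewrite mulnS !natrD; ring.
Qed.

(** The quotient by X - 1 takes at 1 the value of the derivative, here the sum of the first n odd
    numbers. *)
Lemma dirichlet_quotient_horner1 n :
  (dirichlet R n %/ ('X - 1%:P)).[1] = ((n ^ 2)%N%:R : R)%:C%C.
Proof.
rewrite rmorph_nat; transitivity ((dirichlet R n)^`()).[1].
  have := divp_eq (dirichlet R n) ('X - 1%:P); rewrite modp_XsubC.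
  set K := _ %/ _ => ->.
  rewrite derivD derivC derivM derivXsubC !(hornerD, hornerM, hornerN, hornerX, hornerC).
  ring.
elim: n => [|n IH]; first by rewrite /dirichlet big_ord0 deriv0 horner0.
rewrite /dirichlet big_ord_recr /= derivD hornerD IH derivD hornerD !derivXn.
by rewrite !hornerMn !hornerXn !expr1n -!natrD; congr (_%:R); lia.
Qed.

(** The integrands agree pointwise: with t as in [dirichlet_circle], both equal t^2 (1 - Re z^n).
    The point 1 may carry mass and is checked separately; both sides are 2 n^2 there. *)
Lemma second_kind_dirichlet (mu : {finite_measure set (borelC R) -> \bar R}) n :
  second_kind mu (dirichlet R n) =
  re_form mu (dirichlet R n) (dirichlet R n) / 2.
Proof.
rewrite mulrC -re_formZl /second_kind; apply: eq_re_form => z Cz.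
have [->|z1] := eqVneq z 1; last first.
  rewrite second_kind_integrand //; last exact: dirichlet_real.
  have [e1 e2] := dirichlet_circle n Cz z1.
  rewrite hornerZ -[in RHS]mulrA cReM cReR cImR mul0r subr0 e2 e1; field.
  by rewrite lt0r_neq0 // chord_sqr_gt0.
rewrite hornerM hornerD hornerX !hornerC hornerZ dirichlet_quotient_horner1.
rewrite dirichlet_horner1 conj_real_complex.
rewrite !(cReM, cImM, cReD, cImD, cReJ, cImJ, cReR, cImR) /= natrX natrM; by field.
Qed.

End Dirichlet.

Lemma eventually_le_limn_einf (R : realType) (x : \bar R) (u : (\bar R)^nat) N :
  (forall n, (N <= n)%N -> (x <= u n)%E) -> (x <= limn_einf u)%E.
Proof.
move=> h; rewrite limn_einf_lim; apply: lime_ge.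
  exact/ereal_nondecreasing_is_cvgn/nondecreasing_einfs.
exists N => // n /= Nn; apply: le_ereal_inf_tmp => _ [k /= nk <-].
by apply: h; exact: leq_trans nk.
Qed.

Lemma limn_einf_le (R : realType) (x : \bar R) (u : (\bar R)^nat) :
  (forall n, (u n <= x)%E) -> (limn_einf u <= x)%E.
Proof.
move=> h; rewrite limn_einf_lim; apply: lime_le.
  exact/ereal_nondecreasing_is_cvgn/nondecreasing_einfs.
apply: nearW => n; apply: le_trans (h n); apply: ereal_inf_lbound.
by exists n => /=.
Qed.

(** * Averages of the test polynomials dominate the integrand of J *)

Section Average.
Variable R : realType.
Implicit Types (z : Cplx R).

Definition dirichlet_sqr n z : R :=
  complex.Re ((dirichlet R n).[z] * (dirichlet R n).[z]^*).

(** The added 1 is there because every D_k vanishes at z = -1, where the integrand of J is 1/4. *)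
Definition dirichlet_mean n z : R :=
  n.+1%:R^-1 * \sum_(k < n.+1) dirichlet_sqr k.+1 z + 1.

Lemma dirichlet_sqr_ge0 n z : 0 <= dirichlet_sqr n z.
Proof.
by rewrite /dirichlet_sqr cReM cReJ cImJ mulrN opprK addr_ge0 // -expr2 sqr_ge0.
Qed.

Lemma dirichlet_mean_ge0 n z : 0 <= dirichlet_mean n z.
Proof.
rewrite addr_ge0 // mulr_ge0 ?invr_ge0 ?ler0n // sumr_ge0 // => k _.
exact: dirichlet_sqr_ge0.
Qed.

(** The geometric sum is (z - z^(n+1)) / (1 - z), of modulus at most 2 / |1 - z|, and |1 - z| <= 2.
    The bound does not depend on n. *)
Lemma sum_Re_powers_le z n : circle R z -> z != 1 ->
  \sum_(k < n) complex.Re (z ^+ k.+1) <= 4 / chord_sqr z.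
Proof.
move=> Cz z1; have n0 := chord_sqr_gt0 Cz z1.
pose G : Cplx R := \sum_(k < n) z ^+ k.+1.
have -> : \sum_(k < n) complex.Re (z ^+ k.+1) = complex.Re G.
  by apply/esym; apply: (big_morph (fun w : Cplx R => complex.Re w) (@cReD R)).
have e : (1 - z) * G = z - z ^+ n.+1.
  rewrite /G; elim: n {G} => [|n IH]; first by rewrite big_ord0 mulr0 expr1 subrr.
  by rewrite big_ord_recr /= mulrDr IH [z ^+ n.+2]exprS; ring.
have /circleE hw := circleX n.+1 Cz; have /circleE h := Cz.
move: hw e; set w := z ^+ n.+1 => hw e.
have e1 := congr1 (fun r : Cplx R => complex.Re r) e.
have e2 := congr1 (fun r : Cplx R => complex.Im r) e.
move: e1 e2; rewrite /= !(cReM, cImM, cReD, cImD, cReN, cImN) /=.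
have nE : chord_sqr z = 2 - 2 * complex.Re z by [].
rewrite ler_pdivlMr //.
move: (complex.Re G) (complex.Im G) (complex.Re w) (complex.Im w) hw => u v c s hw.
move: (complex.Re z) (complex.Im z) h nE => x y h nE e1 e2.
have nsq : chord_sqr z = (1 - x) ^+ 2 + y ^+ 2.
  by rewrite nE; transitivity (1 - 2 * x + (x ^+ 2 + y ^+ 2)); [rewrite h|]; ring.
have -> : u * chord_sqr z = (1 - x) * (x - c) - y * (y - s).
  by rewrite nsq -e1 -e2; ring.
have := sqr_ge0 (x - 1); have := sqr_ge0 (c + 1); have := sqr_ge0 (x - c).
have := sqr_ge0 (y - s); have := sqr_ge0 y; have := sqr_ge0 s; nra.
Qed.

(** The threshold 8 / |z - 1|^2 makes the sum of Re z^k at most half of n + 1, so the average is at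
    least t^2 = 4 / |z - 1|^2 - 1; the added 1 then gives more than required. *)
Lemma dirichlet_mean_ge z n : circle R z -> z != 1 ->
  8 / chord_sqr z <= n.+1%:R -> (chord_sqr z)^-1 <= dirichlet_mean n z.
Proof.
move=> Cz z1 hn; have n0 := chord_sqr_gt0 Cz z1.
rewrite /dirichlet_mean; set t := 2 * complex.Im z / chord_sqr z.
have -> : \sum_(k < n.+1) dirichlet_sqr k.+1 z =
    2 * t ^+ 2 * (n.+1%:R - \sum_(k < n.+1) complex.Re (z ^+ k.+1)).
  transitivity (\sum_(k < n.+1) 2 * t ^+ 2 * (1 - complex.Re (z ^+ k.+1))).
    by apply: eq_bigr => k _; rewrite /dirichlet_sqr; have [_ ->] := dirichlet_circle k.+1 Cz z1.
  by rewrite -mulr_sumr sumrB sumr_const card_ord.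
have hs := sum_Re_powers_le n.+1 Cz z1.
have N0 : (0 : R) < n.+1%:R by rewrite ltr0n.
have tE : t ^+ 2 = 4 / chord_sqr z - 1.
  have y2 : 4 * complex.Im z ^+ 2 = chord_sqr z * (4 - chord_sqr z).
    by have /circleE h := Cz; rewrite /chord_sqr; nra.
  transitivity (4 * complex.Im z ^+ 2 / chord_sqr z ^+ 2).
    by rewrite /t; field; exact: lt0r_neq0.
  by rewrite y2; field; exact: lt0r_neq0.
have half : n.+1%:R / 2 <= n.+1%:R - \sum_(k < n.+1) complex.Re (z ^+ k.+1).
  by rewrite (_ : 8 / _ = 2 * (4 / chord_sqr z)) in hn; [lra|ring].
have : t ^+ 2 <= n.+1%:R^-1 * (2 * t ^+ 2 * (n.+1%:R - \sum_(k < n.+1) complex.Re (z ^+ k.+1))).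
  rewrite mulrC ler_pdivlMr //; have := sqr_ge0 t; nra.
have : 0 < (chord_sqr z)^-1 by rewrite invr_gt0.
move: tE; set w := (chord_sqr z)^-1; set A := _^-1 * _; lra.
Qed.

(** Divergence at the pole matches the infinite value of the integrand there, so a point mass at 1
    is detected. *)
Lemma dirichlet_mean1 n : n.+1%:R <= dirichlet_mean n (1 : Cplx R).
Proof.
rewrite /dirichlet_mean ler_wpDr // mulrC ler_pdivlMr ?ltr0n //.
have hk k : dirichlet_sqr k (1 : Cplx R) = ((2 * k) ^ 2)%N%:R.
  rewrite /dirichlet_sqr dirichlet_horner1 conj_real_complex.
  by rewrite cReM cReR cImR mul0r subr0 natrX expr2.
under eq_bigr do rewrite hk.
rewrite -natr_sum -natrM ler_nat.
elim: n => [|n IH]; first by rewrite big_ord_recr big_ord0.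
by rewrite big_ord_recr /=; move: IH; set s := (\sum_(_ < _) _)%N; lia.
Qed.

Lemma J_integrand_le_limn_einf z : circle R z ->
  (J_integrand z <= limn_einf (fun n => (dirichlet_mean n z)%:E))%E.
Proof.
move=> Cz; have [->|z1] := eqVneq z 1.
  rewrite /J_integrand eqxx leye_eq; apply/eqP/eqyP => A A0.
  apply: (@eventually_le_limn_einf _ _ _ (Num.truncn A)) => n An.
  rewrite lee_fin (le_trans _ (dirichlet_mean1 n)) //.
  by rewrite (le_trans (ltW (truncnS_gt A))) // ler_nat ltnS.
rewrite J_integrandE //.
apply: (@eventually_le_limn_einf _ _ _ (Num.truncn (8 / chord_sqr z))) => n An.
rewrite lee_fin dirichlet_mean_ge //.
by rewrite (le_trans (ltW (truncnS_gt _))) // ler_nat ltnS.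
Qed.

End Average.

(** * Integrability *)

Section Total.
Variables (R : realType) (mu : {finite_measure set (borelC R) -> \bar R}).

Lemma fine_circle_integral (f : borelC R -> R) : circle_bounded_fun f ->
  (Rintegral mu (circle R) f)%:E = (\int[mu]_(z in circle R) (f z)%:E)%E.
Proof.
move=> bf; rewrite fineK //; apply: integrable_fin_num.
  exact: measurable_circle.
exact: circle_bounded_integrable.
Qed.

Lemma re_form11_gt0 : mu (~` circle R) = 0%E ->
  infinite_set (measure_support mu) -> 0 < re_form mu 1 1.
Proof.
move=> mC infS; have mcirc := @measurable_circle R.
have [z Sz] := infinite_setN0 infS.
have : (0 < mu setT)%E by apply: Sz => //; exact: openT.
rewrite -(setvU (circle R)) measureU ?setICl //; last exact: measurableC.
rewrite /= mC add0e => m0.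
have -> : re_form mu 1 1 = fine (mu (circle R)).
  rewrite -[RHS]mul1r -Rintegral_cst //; apply: eq_Rintegral => z' _.
  by rewrite hornerC rmorph1 mulr1.
by rewrite fine_gt0 // m0 /= ltey_eq fin_num_measure.
Qed.

Lemma dirichlet_sqr_bounded n : circle_bounded_fun (@dirichlet_sqr R n).
Proof. exact: re_form_integrand_bounded. Qed.

Lemma sum_dirichlet_sqr_bounded n :
  @circle_bounded_fun R (fun z => \sum_(k < n) dirichlet_sqr k.+1 z).
Proof.
elim: n => [|n IH].
  by under eq_fun do rewrite big_ord0; exact: circle_bounded_cst.
under eq_fun do rewrite big_ord_recr.
by apply: circle_boundedD => //; exact: dirichlet_sqr_bounded.
Qed.

Lemma dirichlet_mean_bounded n : circle_bounded_fun (@dirichlet_mean R n).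
Proof.
apply: circle_boundedD (circle_bounded_cst _).
exact: circle_boundedM (circle_bounded_cst _) (sum_dirichlet_sqr_bounded _).
Qed.

Lemma integral_dirichlet_mean_le (C : R) n :
  (forall k, re_form mu (dirichlet R k) (dirichlet R k) <= C) ->
  Rintegral mu (circle R) (@dirichlet_mean R n) <= C + fine (mu (circle R)).
Proof.
move=> hC; have mcirc := @measurable_circle R.
have hs m : Rintegral mu (circle R)
    (fun z => \sum_(k < m) dirichlet_sqr k.+1 z) <= m%:R * C.
  elim: m => [|m IH].
    rewrite (_ : (fun _ => _) = cst 0); last by apply/funext => z; rewrite big_ord0.
    by rewrite Rintegral_cst // !mul0r.
  rewrite (_ : (fun _ => _) = (fun z => \sum_(k < m) dirichlet_sqr k.+1 z +
    dirichlet_sqr m.+1 z)); last by apply/funext => z; rewrite big_ord_recr.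
  rewrite RintegralD //; last 2 first.
  - exact/circle_bounded_integrable/sum_dirichlet_sqr_bounded.
  - exact/circle_bounded_integrable/dirichlet_sqr_bounded.
  by rewrite -natr1 mulrDl mul1r lerD // hC.
have bs := sum_dirichlet_sqr_bounded n.+1.
rewrite /dirichlet_mean RintegralD //; last 2 first.
- apply: circle_bounded_integrable.
  exact: circle_boundedM (circle_bounded_cst _) bs.
- exact/circle_bounded_integrable/circle_bounded_cst.
rewrite Rintegral_cst // mul1r RintegralZl //; last exact: circle_bounded_integrable.
by rewrite lerD // mulrC ler_pdivrMr ?ltr0n // mulrC.
Qed.

Lemma J_exists_of_bound (C : R) :
  (forall k, re_form mu (dirichlet R k) (dirichlet R k) <= C) -> J_exists mu.
Proof.
move=> hC; have mcirc := @measurable_circle R.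
have mmean n : measurable_fun (circle R : set (borelC R))
    (fun z => (dirichlet_mean n z)%:E).
  by apply/measurable_EFinP; apply: measurable_funS (dirichlet_mean_bounded n).1.
apply/integrableP; split; first exact: measurable_J_integrand.
have -> : (\int[mu]_(z in circle R) `|J_integrand z| =
           \int[mu]_(z in circle R) J_integrand z)%E.
  by apply: eq_integral => z /[!inE] Cz; rewrite gee0_abs // J_integrand_ge0.
(* Fatou's lemma moves the lower limit outside the integral, where the means are uniformly
   bounded. *)
apply: (@le_lt_trans _ _
    (\int[mu]_(z in circle R) limn_einf (fun n => (dirichlet_mean n z)%:E))%E).
  apply: ge0_le_integral => //.
  - exact: J_integrand_ge0.
  - exact: measurable_J_integrand.
  - apply: measurableT_comp => //; apply: measurable_fun_limn_esup => n.
    exact: measurableT_comp.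
  - exact: J_integrand_le_limn_einf.
apply: le_lt_trans (fatou mu mcirc mmean _) _.
  by move=> n z _; rewrite lee_fin dirichlet_mean_ge0.
apply: (@le_lt_trans _ _ (C + fine (mu (circle R)))%:E); last exact: ltry.
apply: limn_einf_le => n; rewrite -fine_circle_integral ?lee_fin.
  exact: integral_dirichlet_mean_le.
exact: dirichlet_mean_bounded.
Qed.

(** Applied to a representer, whose [second_kind] is its own squared norm, the quadratic term is
    absorbed by the left side. *)
Lemma second_kind_le_J p : J_exists mu -> real_poly p ->
  second_kind mu p <=
    2 * fine (\int[mu]_(z in circle R) J_integrand z)%E + re_form mu p p / 2.
Proof.
move=> iJ rp; have mcirc := @measurable_circle R.
have fJ := integrable_fin_num mcirc iJ.
rewrite [re_form _ _ _ / _]mulrC -re_formZl -lee_fin EFinD EFinM (fineK fJ).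
rewrite /second_kind /re_form !fine_circle_integral;
  try exact: re_form_integrand_bounded.
have ip := re_form_integrable mu (2^-1%:C%C *: p) p.
have iJ2 := integrableZl mcirc 2 iJ.
rewrite -integralZl // -integralD //; apply: le_integral => //.
- exact: re_form_integrable.
- exact: integrableD.
move=> z /[!inE] Cz; apply: le_trans (second_kind_integrand_le Cz rp) _.
by rewrite hornerZ -[in leRHS]mulrA (@cReM R 2^-1%:C%C) cReR cImR mul0r subr0 mulrC.
Qed.

End Total.

Theorem corollary4p2p1 (R : realType) (alpha : nat -> R)
    (alpha_lt1 : forall n : nat, `|alpha n| < 1)
    (mu : {finite_measure set (borelC R) -> \bar R})
    (mu_circle : mu (~` circle R) = 0%E)
    (mu_infinite : infinite_set (measure_support mu))
    (mu_alpha : forall n : nat, is_verblunsky mu n (alpha n)%:C%C) :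
  J_exists mu <->
  cvgn (fun N : nat => \sum_(1 <= n < N.+1)
          \prod_(1 <= k < n.+1) ((1 + alpha k.-1) / (1 - alpha k.-1))).
Proof.
have {mu_circle mu_infinite} m0 := re_form11_gt0 mu_circle mu_infinite.
have a_bounds n : -1 < alpha n /\ alpha n < 1.
  by have := alpha_lt1 n; rewrite ltr_norml => /andP[].
have T_nd : nondecreasing_seq (second_kind_series alpha).
  apply/nondecreasing_seqP => n; rewrite {2}/second_kind_series big_nat_recr //=.
  rewrite lerDl prodr_ge0 // => k _; have [h1 h2] := a_bounds k.-1.
  by rewrite divr_ge0; lra.
have reprE := representerP mu_alpha alpha_lt1.
have normE := representer_norm mu_alpha alpha_lt1.
change (J_exists mu <-> cvgn (second_kind_series alpha)); split=> [iJ|cT].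
  apply: nondecreasing_is_cvgn T_nd _.
  (* For the representer phi, |phi|^2 <= 2 J + |phi|^2 / 2 gives |phi|^2 <= 4 J, and |phi|^2 is m0
     times the partial sum. *)
  exists (4 * fine (\int[mu]_(z in circle R) J_integrand z)%E / re_form mu 1 1).
  move=> _ [n _ <-]; rewrite ler_pdivlMr // mulrC -normE.
  have rphi := representer_real alpha n.
  have := second_kind_le_J iJ rphi.
  rewrite -(reprE n) ?size_representer //; lra.
pose B := limn (second_kind_series alpha).
apply: (@J_exists_of_bound _ _ (4 * (re_form mu 1 1 * B))) => k.
(* Expanding |D/2 - phi|^2 >= 0 with the pairing of D and phi equal to |D|^2 / 2 gives |D|^2 <= 4
   |phi|^2, whence the constant 4 m0 B. *)
have := re_form_ge0 mu ((2^-1)%:C%C *: dirichlet R k - representer alpha k).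
rewrite !(re_formBl, re_formBr, re_formZl, re_formZr).
rewrite (re_formC mu (representer _ _) (dirichlet _ _)) normE.
rewrite (reprE k _ (dirichlet_real R k) (size_dirichlet R k)).
rewrite second_kind_dirichlet.
have : re_form mu 1 1 * second_kind_series alpha k <= re_form mu 1 1 * B.
  by rewrite ler_pM2l //; exact: nondecreasing_cvgn_le.
lra.
Qed.
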